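(* Via the map $f$, the $|-1|$-Riedtmann configurations in $\mathsf{T}_{-1}$ are in one-to-one correspondence with the noncrossing partitions of $\mathbb{Z}$ with at most one infinite block whose infinite block, if it exists, has neither an upper bound nor a lower bound.
   Context: Let $K$ be an algebraically closed field, $w=-1$, $d=w-1=-2$. $\mathsf{T}=\mathsf{T}_{-1}$ denotes a $K$-linear idempotent complete algebraic triangulated category, with shift $\Sigma$, classically generated by a $(-1)$-spherical object, i.e. an object $s$ with $\dim_K\mathrm{Hom}(s,\Sigma^i s)=1$ if $i\in\{0,-1\}$ and $0$ otherwise. It is known that $\mathsf{T}$ is unique up to triangle equivalence, Krull–Schmidt with finite dimensional Hom-spaces, and $(-1)$-Calabi–Yau: $\mathrm{Hom}(x,y)\cong D\,\mathrm{Hom}(y,\Sigma^{-1}x)$ bifunctorially. Arc model. The vertices of the $\infty$-gon are the integers. An admissible arc is a pair $(t,u)$ of integers with $t>u$ and $t-u$ odd. Isomorphism classes of indecomposable objects of $\mathsf{T}$ are identified with admissible arcs in such a way that $\Sigma(t,u)=(t-1,u-1)$ and the arrows of the Auslander–Reiten quiver are $(t,u)\to(t,u-2)$ and $(t,u)\to(t-2,u)$ whenever the target is admissible (this fixes the identification up to powers of $\Sigma$; fix one such identification). Under it, for $x=(t,u)$ and $k:=\frac{t-u+1}{2}$, $\dim_K\mathrm{Hom}(x,y)=1$ if $y$ is an admissible arc of the form $(t-2i,v)$ with $0\le i\le k-1$, $v\le u$, or of the form $(z,u+1+2i)$ with $0\le i\le k-1$, $z\ge t+1$; otherwise $\mathrm{Hom}(x,y)=0$.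 A $|-1|$-Hom-configuration is a collection $\mathsf{H}$ of (isomorphism classes of) indecomposable objects such that, for every indecomposable $h$, one has $h\in\mathsf{H}$ if and only if $\mathrm{Hom}(x,\Sigma^i h)=0$ for all $x\in\mathsf{H}\setminus\{h\}$ and $i=0,-1$. A collection $\mathsf{C}$ of indecomposable objects is a left $|-1|$-Riedtmann configuration if (a) $\mathrm{Hom}(x,\Sigma^i y)=0$ for all $x\ne y$ in $\mathsf{C}$ and $i\in\{-1,0\}$, and (b) for every indecomposable $z$ there is $x\in\mathsf{C}$ with $\mathrm{Hom}(x,z)\neq0$; it is a right $|-1|$-Riedtmann configuration if it satisfies (a) and (b$'$) for every indecomposable $z$ there is $x\in\mathsf{C}$ with $\mathrm{Hom}(z,x)\ne0$. Every left or right $|-1|$-Riedtmann configuration is a $|-1|$-Hom-configuration, and the left and right notions coincide; such a collection is called a $|-1|$-Riedtmann configuration. A noncrossing partition of $\mathbb{Z}$ is a set of pairwise disjoint non-empty subsets (blocks) whose union is $\mathbb{Z}$, such that no two blocks cross; i.e. there are no distinct blocks $B,B'$ and $a<b<c<e$ with $a,c\in B$ and $b,e\in B'$. The map $f$. Let $\mathbb{Z}'$ be the copy of $\mathbb{Z}$ consisting of the points $n':=0.5+2n$, $n\in\mathbb{Z}$; it is identified with $\mathbb{Z}$ via $n'\leftrightarrow n$. For a $|-1|$-Hom-configuration $\mathsf{H}$, $f(\mathsf{H})$ is the partition of $\mathbb{Z}'$ whose blocks, with elements listed in increasing order, are determined as follows: given an element $n'$ of a block, if $\mathsf{H}$ contains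 an arc of the form $(m,n'+0.5)$, then the next element of the block after $n'$ is $m+0.5$; otherwise (if $n'+0.5$ is incident with an arc of $\mathsf{H}$ of the form $(n'+0.5,m)$, or is not incident with any arc of $\mathsf{H}$) $n'$ is the last element of its block. *)

(* Defs.v *)
From Stdlib Require Import Relations.
From HB Require Import structures.
From mathcomp Require Import all_boot all_order all_algebra.
From mathcomp Require Import mathcomp_extra boolp classical_sets functions.
From mathcomp Require Import cardinality.

Set Implicit Arguments.
Unset Strict Implicit.
Unset Printing Implicit Defensive.

Import Order.TTheory GRing.Theory Num.Theory.
Local Open Scope classical_set_scope.
Local Open Scope ring_scope.

Record linCat (K : fieldType) := LinCat {
  obj :> Type;
  hom : obj -> obj -> lmodType K;
  idm : forall x, hom x x;
  ccomp : forall x y z, hom y z -> hom x y -> hom x z;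
  comp_linearr : forall x y z (g : hom y z),
    linear (fun f : hom x y => ccomp g f);
  comp_linearl : forall x y z (f : hom x y),
    linear (fun g : hom y z => ccomp g f);
  compA : forall x y z t (h : hom z t) (g : hom y z) (f : hom x y),
    ccomp h (ccomp g f) = ccomp (ccomp h g) f;
  comp1m : forall x y (f : hom x y), ccomp (idm y) f = f;
  compm1 : forall x y (f : hom x y), ccomp f (idm x) = f }.

Arguments idm {K l} x.
Arguments ccomp {K l x y z} g f.

Declare Scope lincat_scope.
Notation "g '\oc' f" := (ccomp g f) (at level 40, left associativity) :
  lincat_scope.
Local Open Scope lincat_scope.

Definition has_dim (K : fieldType) (V : lmodType K) (n : nat) : Prop :=
  inhabited (Vector.axiom n V).

Section Categories.
Context {K : fieldType} {C : linCat K}.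
Implicit Types x y z t : C.

Definition is_iso x y (f : hom x y) : Prop :=
  exists g : hom y x, g \oc f = idm x /\ f \oc g = idm y.

Definition isom x y : Prop := exists f : hom x y, is_iso f.

Definition is_zero x : Prop := idm x = 0.

Definition is_biproduct x y z : Prop :=
  exists (i1 : hom x z) (i2 : hom y z) (p1 : hom z x) (p2 : hom z y),
    [/\ p1 \oc i1 = idm x, p2 \oc i2 = idm y, p2 \oc i1 = 0, p1 \oc i2 = 0
      & i1 \oc p1 + i2 \oc p2 = idm z].

Definition indecomposable x : Prop :=
  ~ is_zero x /\ forall y z, is_biproduct y z x -> is_zero y \/ is_zero z.

Definition split_mono x y (f : hom x y) : Prop :=
  exists r : hom y x, r \oc f = idm x.

Definition split_epi x y (f : hom x y) : Prop :=
  exists s : hom y x, f \oc s = idm y.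

Definition irreducible x y (f : hom x y) : Prop :=
  [/\ ~ split_mono f, ~ split_epi f
    & forall z (h : hom x z) (g : hom z y),
        f = g \oc h -> split_mono h \/ split_epi g].

Definition is_kernel x y z (i : hom x y) (p : hom y z) : Prop :=
  p \oc i = 0 /\
  forall t (f : hom t y), p \oc f = 0 -> exists! g : hom t x, i \oc g = f.

Definition is_cokernel x y z (i : hom x y) (p : hom y z) : Prop :=
  p \oc i = 0 /\
  forall t (f : hom y t), f \oc i = 0 -> exists! g : hom z t, g \oc p = f.

Definition is_pushout x y x' y'
    (i : hom x y) (a : hom x x') (b : hom y y') (i' : hom x' y') : Prop :=
  b \oc i = i' \oc a /\
  forall t (f : hom y t) (g : hom x' t), f \oc i = g \oc a ->
    exists! h : hom y' t, h \oc b = f /\ h \oc i' = g.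

Definition is_pullback y z y' z'
    (p' : hom y' z') (b : hom y' y) (c : hom z' z) (p : hom y z) : Prop :=
  p \oc b = c \oc p' /\
  forall t (f : hom t y) (g : hom t z'), p \oc f = c \oc g ->
    exists! h : hom t y', b \oc h = f /\ p' \oc h = g.

End Categories.

Definition additive_cat (K : fieldType) (C : linCat K) : Prop :=
  (exists z : C, is_zero z) /\
  forall x y : C, exists z : C, is_biproduct x y z.

Definition idempotent_complete (K : fieldType) (C : linCat K) : Prop :=
  forall (x : C) (e : hom x x), e \oc e = e ->
    exists (y : C) (r : hom x y) (s : hom y x),
      r \oc s = idm y /\ s \oc r = e.

Record linFunctor (K : fieldType) (C D : linCat K) := LinFunctor {
  fobj :> C -> D;
  fmap : forall x y : C, hom x y -> hom (fobj x) (fobj y);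
  fmap_linear : forall x y : C, linear (@fmap x y);
  fmap1 : forall x : C, fmap (idm x) = idm (fobj x);
  fmapM : forall (x y z : C) (g : hom y z) (f : hom x y),
    fmap (g \oc f) = fmap g \oc fmap f }.

Arguments fmap {K C D} F {x y} f : rename.

(* The shift is an autoequivalence; [unshift] is the object part of a
   quasi-inverse, and [dist] is the class of distinguished triangles.  *)
Record triCat (K : fieldType) := TriCat {
  tcat :> linCat K;
  tri_additive : additive_cat tcat;
  shift : linFunctor tcat tcat;
  unshift : tcat -> tcat;
  shift_ff : forall x y : tcat, bijective (@fmap _ _ _ shift x y);
  unshiftK : forall x : tcat, isom (shift (unshift x)) x;
  dist : forall x y z : tcat,
    hom x y -> hom y z -> hom z (shift x) -> Prop;
  dist_iso : forall (x y z x' y' z' : tcat)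
    (u : hom x y) (v : hom y z) (w : hom z (shift x))
    (u' : hom x' y') (v' : hom y' z') (w' : hom z' (shift x'))
    (a : hom x x') (b : hom y y') (c : hom z z'),
    is_iso a -> is_iso b -> is_iso c ->
    b \oc u = u' \oc a -> c \oc v = v' \oc b ->
    fmap shift a \oc w = w' \oc c ->
    dist u v w -> dist u' v' w';
  dist_id : forall x z : tcat, is_zero z ->
    dist (idm x) (0 : hom x z) (0 : hom z (shift x));
  dist_cone : forall (x y : tcat) (u : hom x y),
    exists (z : tcat) (v : hom y z) (w : hom z (shift x)), dist u v w;
  dist_rot : forall (x y z : tcat)
    (u : hom x y) (v : hom y z) (w : hom z (shift x)),
    dist u v w <-> dist v w (- fmap shift u);
  dist_map : forall (x y z x' y' z' : tcat)
    (u : hom x y) (v : hom y z) (w : hom z (shift x))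
    (u' : hom x' y') (v' : hom y' z') (w' : hom z' (shift x'))
    (a : hom x x') (b : hom y y'),
    dist u v w -> dist u' v' w' -> b \oc u = u' \oc a ->
    exists c : hom z z',
      c \oc v = v' \oc b /\ fmap shift a \oc w = w' \oc c;
  dist_octahedron : forall (x y z z' x' y' : tcat)
    (u : hom x y) (j : hom y z') (k : hom z' (shift x))
    (v : hom y z) (l : hom z x') (i : hom x' (shift y))
    (m : hom z y') (n : hom y' (shift x)),
    dist u j k -> dist v l i -> dist (v \oc u) m n ->
    exists (f : hom z' y') (g : hom y' x'),
      dist f g (fmap shift j \oc i) /\
      [/\ f \oc j = m \oc v, n \oc f = k, g \oc m = l
        & i \oc g = fmap shift u \oc n] }.

Arguments shift {K} t.
Arguments unshift {K t} x : rename.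
Arguments dist {K t x y z} u v w : rename.

(* The i-th power of the shift on objects, up to isomorphism. *)
Definition shiftz (K : fieldType) (T : triCat K) (i : int) (x : T) : T :=
  match i with
  | Posz n => iter n (shift T) x
  | Negz n => iter n.+1 unshift x
  end.

Definition thick (K : fieldType) (T : triCat K) (P : set T) : Prop :=
  [/\ forall x, P x -> P (shift T x),
      forall x, P x -> P (unshift x),
      forall x y z (u : hom x y) (v : hom y z) (w : hom z (shift T x)),
        dist u v w -> P x -> P y -> P z
    & forall x y (s : hom y x) (r : hom x y),
        r \oc s = idm y -> P x -> P y].

Definition classical_generator (K : fieldType) (T : triCat K) (s : T) : Prop :=
  forall P : set T, thick P -> P s -> forall x, P x.

Definition spherical_m1 (K : fieldType) (T : triCat K) (s : T) : Prop :=
  forall i : int,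
    has_dim (hom s (shiftz i s)) (if (i == 0) || (i == -1) then 1%N else 0%N).

(* Exact structures in the sense of Quillen, with Buehler's axioms. *)
Record exactCat (K : fieldType) := ExactCat {
  ecat :> linCat K;
  exact_additive : additive_cat ecat;
  conflation : forall x y z : ecat, hom x y -> hom y z -> Prop;
  inflation := fun (x y : ecat) (i : hom x y) =>
    exists (z : ecat) (p : hom y z), conflation i p;
  deflation := fun (y z : ecat) (p : hom y z) =>
    exists (x : ecat) (i : hom x y), conflation i p;
  conflation_kc : forall (x y z : ecat) (i : hom x y) (p : hom y z),
    conflation i p -> is_kernel i p /\ is_cokernel i p;
  conflation_iso : forall (x y z x' y' z' : ecat)
    (i : hom x y) (p : hom y z) (i' : hom x' y') (p' : hom y' z')
    (a : hom x x') (b : hom y y') (c : hom z z'),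
    is_iso a -> is_iso b -> is_iso c ->
    b \oc i = i' \oc a -> c \oc p = p' \oc b ->
    conflation i p -> conflation i' p';
  inflation_id : forall x : ecat, inflation (idm x);
  deflation_id : forall x : ecat, deflation (idm x);
  inflation_comp : forall (x y z : ecat) (i : hom x y) (j : hom y z),
    inflation i -> inflation j -> inflation (j \oc i);
  deflation_comp : forall (x y z : ecat) (p : hom x y) (q : hom y z),
    deflation p -> deflation q -> deflation (q \oc p);
  inflation_pushout : forall (x y x' : ecat) (i : hom x y) (a : hom x x'),
    inflation i -> exists (y' : ecat) (b : hom y y') (i' : hom x' y'),
      is_pushout i a b i' /\ inflation i';
  deflation_pullback : forall (y z z' : ecat) (p : hom y z) (c : hom z' z),
    deflation p -> exists (y' : ecat) (b : hom y' y) (p' : hom y' z'),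
      is_pullback p' b c p /\ deflation p' }.

Arguments conflation {K e x y z} i p : rename.
Arguments inflation {K} e {x y} i : rename.
Arguments deflation {K} e {y z} p : rename.

Definition projective (K : fieldType) (E : exactCat K) (q : E) : Prop :=
  forall (y z : E) (p : hom y z) (f : hom q z),
    deflation E p -> exists g : hom q y, p \oc g = f.

Definition injective_obj (K : fieldType) (E : exactCat K) (q : E) : Prop :=
  forall (x y : E) (i : hom x y) (f : hom x q),
    inflation E i -> exists g : hom y q, g \oc i = f.

Definition frobenius (K : fieldType) (E : exactCat K) : Prop :=
  [/\ forall x : E, exists (q : E) (p : hom q x),
        projective q /\ deflation E p,
      forall x : E, exists (q : E) (i : hom x q),
        injective_obj q /\ inflation E i
    & forall q : E, projective q <-> injective_obj q].

(* [F] induces a triangle equivalence from the stable category of [E] (the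
   quotient of [E] by the maps factoring through a projective-injective object)
   to [T].  The suspension of the stable category is given by conflations
   x -> I x -> S x with I x injective, and [theta] is the natural isomorphism
   F (S x) -> shift (F x).  The sign in the standard triangles of a stable
   category is immaterial here since [theta] can be replaced by its opposite. *)
Definition stable_equivalence (K : fieldType) (E : exactCat K) (T : triCat K)
    (F : linFunctor E T) : Prop :=
  [/\ forall (x y : E) (g : hom (F x) (F y)), exists f : hom x y, fmap F f = g,
      forall t : T, exists x : E, isom (F x) t,
      forall (x y : E) (f : hom x y), fmap F f = 0 <->
        exists (q : E) (g : hom q y) (h : hom x q),
          projective q /\ f = g \oc h
    & exists (I S : E -> E) (iota : forall x, hom x (I x))
        (pi : forall x, hom (I x) (S x))
        (theta : forall x, hom (F (S x)) (shift T (F x))),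
      [/\ forall x, injective_obj (I x) /\ conflation (iota x) (pi x),
          forall x, is_iso (theta x),
          forall (x y : E) (f : hom x y) (g : hom (I x) (I y))
              (h : hom (S x) (S y)),
            g \oc iota x = iota y \oc f -> h \oc pi x = pi y \oc g ->
            theta y \oc fmap F h = fmap (shift T) (fmap F f) \oc theta x
        & forall (x y z : E) (i : hom x y) (p : hom y z)
              (g : hom y (I x)) (h : hom z (S x)),
            conflation i p -> g \oc i = iota x -> h \oc p = pi x \oc g ->
            dist (fmap F i) (fmap F p) (theta x \oc fmap F h)]].

Definition algebraic (K : fieldType) (T : triCat K) : Prop :=
  exists (E : exactCat K) (F : linFunctor E T),
    frobenius E /\ stable_equivalence F.

Definition admissible (t u : int) : bool := (u < t) && odd `|t - u|%N.

Record arc := Arc { src : int; tgt : int; arcP : admissible src tgt }.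

Definition hom_support (a b : arc) : Prop :=
  let t := src a in let u := tgt a in
  let k := ((t - u + 1) %/ 2)%Z in
  exists2 i : int, 0 <= i <= k - 1 &
    (src b = t - 2 * i /\ tgt b <= u) \/
    (tgt b = u + 1 + 2 * i /\ t + 1 <= src b).

(* There is an arrow a -> b in the Auslander-Reiten quiver iff there is an
   irreducible morphism; multiplicities are 1 since Hom-spaces have
   dimension at most 1. *)
Record arc_model (K : fieldType) (T : triCat K) := ArcModel {
  arc_obj :> arc -> T;
  arc_indec : forall a, indecomposable (arc_obj a);
  arc_inj : forall a b, isom (arc_obj a) (arc_obj b) -> a = b;
  arc_surj : forall x : T, indecomposable x -> exists a, isom x (arc_obj a);
  arc_shift : forall a b, src b = src a - 1 -> tgt b = tgt a - 1 ->
    isom (shift T (arc_obj a)) (arc_obj b);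
  arc_irr : forall a b,
    (exists f : hom (arc_obj a) (arc_obj b), irreducible f) <->
    (src b = src a /\ tgt b = tgt a - 2) \/
    (src b = src a - 2 /\ tgt b = tgt a);
  arc_hom1 : forall a b, hom_support a b ->
    has_dim (hom (arc_obj a) (arc_obj b)) 1;
  arc_hom0 : forall a b, ~ hom_support a b ->
    has_dim (hom (arc_obj a) (arc_obj b)) 0 }.

Section Riedtmann.
Context {K : fieldType} (T : triCat K).
Implicit Types (C : set T) (x y z : T).

Definition hom_zero x y : Prop := forall f : hom x y, f = 0.

(* A collection of isomorphism classes of indecomposable objects, as an
   isomorphism-closed set of objects. *)
Definition collection C : Prop :=
  (forall x, C x -> indecomposable x) /\
  (forall x y, C x -> isom x y -> C y).

Definition hom_orthogonal C : Prop :=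
  forall x y, C x -> C y -> ~ isom x y -> forall i : int, i = -1 \/ i = 0 ->
    hom_zero x (shiftz i y).

Definition left_riedtmann C : Prop :=
  [/\ collection C, hom_orthogonal C
    & forall z, indecomposable z -> exists2 x, C x & ~ hom_zero x z].

Definition right_riedtmann C : Prop :=
  [/\ collection C, hom_orthogonal C
    & forall z, indecomposable z -> exists2 x, C x & ~ hom_zero z x].

Definition riedtmann C : Prop := left_riedtmann C \/ right_riedtmann C.

End Riedtmann.

Definition noncrossing (P : set (set int)) : Prop :=
  forall B B', P B -> P B' -> B <> B' ->
  ~ exists a b c e : int,
      [/\ a < b, b < c & c < e] /\ [/\ B a, B c, B' b & B' e].

Definition noncrossing_partition (P : set (set int)) : Prop :=
  partition P id setT /\ noncrossing P.

Definition at_most_one_infinite_block (P : set (set int)) : Prop :=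
  forall B B', P B -> P B' -> infinite_set B -> infinite_set B' -> B = B'.

Definition infinite_blocks_unbounded (P : set (set int)) : Prop :=
  forall B, P B -> infinite_set B -> ~ has_ubound B /\ ~ has_lbound B.

(* The point n' = 0.5 + 2n of Z'; [config_partition], the map f, identifies n'
   with n. *)
Definition zprime (n : int) : rat := 1 / 2%:R + 2%:R * n%:~R.

Section MapF.
Context {K : fieldType} {T : triCat K} (phi : arc_model T) (H : set T).

(* p' is the next element after n' in its block: [H] contains an arc
   (m, n' + 0.5) with p' = m + 0.5. *)
Definition next_elt (n p : int) : Prop :=
  exists a : arc,
    [/\ H (phi a), (tgt a)%:~R = zprime n + 1 / 2%:R
      & zprime p = (src a)%:~R + 1 / 2%:R].

(* Two integers of a block are joined by finitely many next-element steps, so the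
   blocks are the classes of the equivalence relation generated by [next_elt]. *)
Definition config_partition : set (set int) :=
  [set B | exists n, B = [set p | clos_refl_sym_trans int next_elt n p]].

End MapF.

(* Main.v *)
From Stdlib Require Import Relations.
From mathcomp Require Import all_boot all_order all_algebra zify ring.
From mathcomp Require Import classical_sets functions boolp cardinality reals.
Require Import Defs.

(** Reading off the Hom-supports of the arc model, condition (a) on a collection
says exactly that its arcs, viewed as pairs of integers, pairwise neither cross
nor share an endpoint ([arcs_orthogonalP]).  Given this, condition (b) says that
every integer is an endpoint of some arc ([perfect_hom_support]): condition (b)
for z = (t, u) asks for an arc joining an integer of the parity of u in the
window u, ..., t - 1 to an integer outside this window.  For the window reduced to one
point this means that the point is matched.  Conversely, if every integer is
matched then such an arc exists, since the window contains one more integer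
of the parity of u than of the other parity while every arc has odd length
([perfect_window]).  The Hom-supports satisfy Hom(b, a) <> 0 iff
Hom(a, unshift b) <> 0, so condition (b') is equivalent to (b).  Hence the
Riedtmann configurations are the noncrossing perfect matchings of the integers
by arcs of odd length ([riedtmannP]).

It remains to see that f is the usual bijection between noncrossing perfect
matchings and noncrossing partitions, in which an integer n is doubled to the
two points 2n and 2n + 1.  Two kinds of arcs occur.  An arc (2p, 2n + 1) says
that p is the successor of n in its block; an arc (2n + 1, 2m) says that m and n
are the least and greatest elements of one block.  Since arcs do not cross, an
arc of the first kind confines every block meeting the open interval from n to p
to that interval, and an arc of the second kind confines every block meeting
[m, n] to it ([step_invariant], [hull_invariant]).  These two invariants yield
that the blocks do not cross, that a block bounded on one side is finite, and
that the matching is recovered from its blocks ([perfect_matchingE]), which is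
injectivity.  For surjectivity, the arcs prescribed by a noncrossing partition
whose infinite blocks are unbounded on both sides form a noncrossing perfect
matching with the given blocks ([arcs_of_partial_matching], [arcs_of_perfect],
[same_block_arcs_of]).  Two infinite blocks unbounded on both sides would cross,
so there is at most one ([unbounded_block_unique]). *)

Set Implicit Arguments.
Unset Strict Implicit.
Unset Printing Implicit Defensive.

Import Order.TTheory GRing.Theory Num.Theory.

Local Open Scope classical_set_scope.
Local Open Scope ring_scope.

(** * Bounded sets of integers *)

Lemma int_ubound_has_maximum (B : set int) (i : int) : B !=set0 -> ubound B i ->
  exists j, B j /\ forall k, B k -> k <= j.
Proof.
move=> [x Bx] ubB.
have [||j [/= Bj minj]] := @int_lbound_has_minimum [set k | B (- k)] (- i).
- by exists (- x); rewrite /= opprK.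
- by move=> k /= Bk; have := ubB _ Bk; lia.
by exists (- j); split=> // k Bk; have := minj (- k); rewrite /= opprK => /(_ Bk); lia.
Qed.

Lemma finite_int_interval (B : set int) (m n : int) :
  (forall x, B x -> m <= x <= n) -> finite_set B.
Proof.
move=> Bmn; apply: (@sub_finite_set _ _ [set` [seq m + k%:Z | k <- iota 0 `|n - m|.+1]]).
  move=> x /Bmn hx; apply/mapP; exists `|x - m|%N; last lia.
  by rewrite mem_iota; lia.
exact: finite_seq.
Qed.

Lemma finite_int_lbound (B : set int) : finite_set B -> has_lbound B.
Proof.
move=> /finite_seqP[s ->]; elim: s => [|x s [y yP]]; first by exists 0.
exists (Num.min x y) => z /=; rewrite inE => /orP[/eqP ->|/yP]; lia.
Qed.

Lemma finite_int_ubound (B : set int) : finite_set B -> has_ubound B.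
Proof.
move=> /finite_seqP[s ->]; elim: s => [|x s [y yP]]; first by exists 0.
exists (Num.max x y) => z /=; rewrite inE => /orP[/eqP ->|/yP]; lia.
Qed.

(** * Arcs and noncrossing matchings *)

Lemma arc_eq (a b : arc) : src a = src b -> tgt a = tgt b -> a = b.
Proof.
case: a b => [t u h] [t' u' h'] /= tE uE; subst t' u'.
by congr Arc; exact: bool_irrelevance.
Qed.

(** The Hom-support with the index i eliminated: the two families are cut out by
a parity condition and inequalities. *)
Lemma hom_supportE (a b : arc) :
  hom_support a b <->
  [/\ ((src b - src a) %% 2)%Z = 0, tgt a < src b <= src a & tgt b <= tgt a] \/
  [/\ ((tgt b - src a) %% 2)%Z = 0, tgt a < tgt b <= src a & src a < src b].
Proof.
have := arcP a; have := arcP b; rewrite /admissible /hom_support /= => hb ha.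
split.
- by case=> i hi [[h1 h2]|[h1 h2]]; [left|right]; split; lia.
- case=> -[h1 h2 h3].
    exists ((src a - src b) %/ 2)%Z; first lia.
    by left; lia.
  exists ((tgt b - tgt a - 1) %/ 2)%Z; first lia.
  by right; lia.
Qed.

Lemma admissible_up (a : arc) : admissible (src a + 1) (tgt a + 1).
Proof. by have := arcP a; rewrite /admissible; lia. Qed.

(** The arc of the inverse shift of the object with arc [a]. *)
Definition arc_up (a : arc) : arc := Arc (admissible_up a).

(** Serre duality for a (-1)-Calabi-Yau category, on the level of supports. *)
Lemma hom_support_serre (a b : arc) :
  hom_support a b <-> hom_support b (arc_up a).
Proof.
have := arcP a; have := arcP b; rewrite /admissible !hom_supportE /= => hb ha.
by split=> -[[h1 h2 h3]|[h1 h2 h3]]; [right|left|right|left]; split; lia.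
Qed.

(** A set of arcs as a relation: [arcs_rel A t u] says that (t, u) lies in [A]. *)
Definition arcs_rel (A : set arc) (t u : int) : Prop :=
  exists a, [/\ A a, src a = t & tgt a = u].

(** Condition (a) of a Riedtmann configuration, on arcs. *)
Definition arcs_orthogonal (A : set arc) : Prop :=
  forall a b, A a -> A b -> a <> b ->
    ~ hom_support a b /\ ~ hom_support a (arc_up b).

(** [M t u] stands for an arc with source t and target u.  No two arcs share an
endpoint ([match_src], [match_tgt], [match_srctgt]) and no two arcs cross. *)
Record partial_matching (M : int -> int -> Prop) : Prop := PartialMatching {
  match_admissible : forall t u, M t u -> admissible t u;
  match_src : forall t u u', M t u -> M t u' -> u = u';
  match_tgt : forall t t' u, M t u -> M t' u -> t = t';
  match_srctgt : forall t u v, M t u -> ~ M v t;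
  match_noncrossing : forall t u t' u', M t u -> M t' u' ->
    u' < u -> u < t' -> t' < t -> False }.

(** Every integer is an endpoint of an arc. *)
Definition perfect (M : int -> int -> Prop) : Prop :=
  forall v, exists w, M v w \/ M w v.

Lemma arcs_orthogonalP (A : set arc) :
  arcs_orthogonal A <-> partial_matching (arcs_rel A).
Proof.
split=> [orthA|[_ fs ft fst nc] a b Aa Ab aNb].
- split.
  + by move=> t u [a [_ <- <-]]; exact: arcP.
  + move=> t u u' [a [Aa ta ua]] [b [Ab tb ub]].
    have [->|/eqP uu'] := eqVneq u u'; first by [].
    exfalso; have aNb : a <> b by move=> ab; subst b; lia.
    have [n1 _] := orthA _ _ Aa Ab aNb.
    have [n2 _] := orthA _ _ Ab Aa (nesym aNb).
    have := arcP a; have := arcP b; rewrite /admissible => pb pa.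
    have [lt|le] := ltP u u'; [apply: n2|apply: n1]; apply/hom_supportE; left;
      split; lia.
  + move=> t t' u [a [Aa ta ua]] [b [Ab tb ub]].
    have [->|/eqP tt'] := eqVneq t t'; first by [].
    exfalso; have aNb : a <> b by move=> ab; subst b; lia.
    have [n1 _] := orthA _ _ Aa Ab aNb.
    have [n2 _] := orthA _ _ Ab Aa (nesym aNb).
    have := arcP a; have := arcP b; rewrite /admissible => pb pa.
    have [lt|le] := ltP t t'; [apply: n2|apply: n1]; apply/hom_supportE; left;
      split; lia.
  + move=> t u v [a [Aa ta ua]] [b [Ab tb ub]].
    have := arcP a; have := arcP b; rewrite /admissible => pb pa.
    have aNb : a <> b by move=> ab; subst b; lia.
    have [n1 _] := orthA _ _ Aa Ab aNb.
    by apply: n1; apply/hom_supportE; right; split; lia.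
  + move=> t u t' u' [a [Aa ta ua]] [b [Ab tb ub]] h1 h2 h3.
    have := arcP a; have := arcP b; rewrite /admissible => pb pa.
    have aNb : a <> b by move=> ab; subst b; lia.
    have [n1 n2] := orthA _ _ Aa Ab aNb.
    have [e|e] : ((t' - t) %% 2 = 0)%Z \/ ((t' - t) %% 2 = 1)%Z by lia.
      by apply: n1; apply/hom_supportE; left; split; lia.
    by apply: n2; apply/hom_supportE; left; split=> /=; lia.
- have ra : arcs_rel A (src a) (tgt a) by exists a.
  have rb : arcs_rel A (src b) (tgt b) by exists b.
  have := arcP a; have := arcP b; rewrite /admissible => pb pa.
  have ss : src a <> src b.
    by move=> e; apply: aNb; apply: arc_eq => //; apply: fs ra _; rewrite e.
  have tt : tgt a <> tgt b.
    by move=> e; apply: aNb; apply: arc_eq => //; apply: ft ra _; rewrite e.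
  have st : src a <> tgt b by move=> e; apply: (fst _ _ _ ra); rewrite e; exact: rb.
  have ts : src b <> tgt a by move=> e; apply: (fst _ _ _ rb); rewrite e; exact: ra.
  have ca := nc _ _ _ _ ra rb; have cb := nc _ _ _ _ rb ra.
  by split=> /hom_supportE[[/= h1 h2 h3]|[/= h1 h2 h3]];
    (apply: ca || apply: cb); lia.
Qed.

(** In a window from p to q of odd size, some integer of the parity of p is
matched outside the window.  By induction on the size: if the partner of p lies in the
window, the part of the window beyond it is again of odd size, and an arc
leaving this part cannot end between p and its partner without crossing the arc
of p. *)
Lemma perfect_window (M : int -> int -> Prop) : partial_matching M -> perfect M ->
  forall (k : nat) (p q : int), q - p = (2 * k)%:Z ->
  exists v w, [/\ p <= v <= q, ((v - p) %% 2)%Z = 0, ~ (p <= w <= q)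
                & M v w \/ M w v].
Proof.
move=> [adm fs ft fst nc] pM k.
elim/ltn_ind: k => k IH p q qp; have [w pw] := pM p.
have [wpq|wNpq] := boolP (p <= w <= q); last first.
  by exists p, w; split=> //; [lia|lia|apply/negP].
have {pw} wp : M w p by case: pw => // /adm; rewrite /admissible; lia.
have := adm _ _ wp; rewrite /admissible => hwp.
pose k' := absz ((q - w - 1) %/ 2)%Z.
have k'k : (k' < k)%N by lia.
have [|v [w' [h1 h2 h3 h4]]] := IH k' k'k (w + 1) q; first by lia.
exists v, w'; split=> //; [lia|lia|].
move=> w'pq; have {h3 w'pq} w'pw : p <= w' <= w by lia.
have w'p : w' <> p.
  by move=> e; subst w'; case: h4 => [/(ft _ _ _ wp)|/fst /(_ wp)]; lia.
have w'w : w' <> w.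
  move=> e; subst w'; case: h4 => [vw|wv]; first exact: (fst _ _ _ wp vw).
  by have := fs _ _ _ wp wv; lia.
case: h4 => [vw'|/adm]; first by apply: (nc _ _ _ _ vw' wp); lia.
by rewrite /admissible; lia.
Qed.

(** Condition (b) amounts to perfectness: the arc z tests the window of integers
from the target of z to the source of z minus 1. *)
Lemma perfect_hom_support (A : set arc) : partial_matching (arcs_rel A) ->
  (forall z, exists2 x, A x & hom_support x z) <-> perfect (arcs_rel A).
Proof.
move=> mA; split=> [domA p|pA z].
  (* The window reduced to the point p. *)
  have adm_p : admissible (p + 1) p by rewrite /admissible; lia.
  have [x Ax /hom_supportE /= xz] := domA (Arc adm_p).
  have := arcP x; rewrite /admissible => px.
  case: xz => -[h1 h2 h3].
    by exists (src x); right; exists x; split=> //; lia.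
  by exists (tgt x); left; exists x; split=> //; lia.
have := arcP z; rewrite /admissible => pz.
have [|v [w [h1 h2 h3 h4]]] :=
  perfect_window mA pA (k := absz ((src z - 1 - tgt z) %/ 2)%Z) (p := tgt z) (q := src z - 1).
  by lia.
case: h4 => -[x [Ax tx ux]]; have := arcP x; rewrite /admissible => px;
  exists x => //; apply/hom_supportE; [right|left]; split; lia.
Qed.

(** * The blocks of a perfect matching *)

(** [p] is the successor of [n]: the map f identifies n with the half-integer
point between 2n and 2n + 1, so the next element is read off from the arc
(2p, 2n + 1). *)
Definition block_step (M : int -> int -> Prop) (n p : int) : Prop :=
  M (2 * p) (2 * n + 1).

Definition same_block (M : int -> int -> Prop) : int -> int -> Prop :=
  clos_refl_sym_trans int (block_step M).

(** [p] is the successor of [n] in its class under [R]. *)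
Definition consecutive (R : int -> int -> Prop) (n p : int) : Prop :=
  [/\ n < p, R n p & forall x, n < x < p -> ~ R n x].

(** [m] and [n] are the least and greatest elements of one class of [R]. *)
Definition extremes (R : int -> int -> Prop) (m n : int) : Prop :=
  [/\ m <= n, R m n & forall x, R n x -> m <= x <= n].

(** The arcs prescribed by the equivalence relation [R]: (2p, 2n + 1) if p is the
successor of n in its class, and (2n + 1, 2m) if m and n are the extremes of a
class.  A singleton class n gives the arc (2n + 1, 2n). *)
Definition arcs_of (R : int -> int -> Prop) (t u : int) : Prop :=
  (exists n p, [/\ t = 2 * p, u = 2 * n + 1 & consecutive R n p]) \/
  (exists m n, [/\ t = 2 * n + 1, u = 2 * m & extremes R m n]).

(** For an equivalence relation [R], its classes are pairwise noncrossing. *)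
Definition noncrossing_rel (R : int -> int -> Prop) : Prop :=
  forall a b c e, a < b -> b < c -> c < e -> R a c -> R b e -> R a b.

Section Blocks.
Variable M : int -> int -> Prop.
Hypothesis mM : partial_matching M.
Hypothesis pM : perfect M.

Lemma same_block_invariant (Q : int -> Prop) :
  (forall x y, block_step M x y -> Q x <-> Q y) ->
  forall x y, same_block M x y -> Q x <-> Q y.
Proof.
move=> Qstep x y; elim=> {x y} [x y /Qstep //|x //|x y _ [] //|].
by move=> x y z _ [? ?] _ [? ?]; split; auto.
Qed.

Lemma block_step_lt n p : block_step M n p -> n < p.
Proof. by move=> /(match_admissible mM); rewrite /admissible; lia. Qed.

(** An element strictly between n and its successor p has its whole block
between n and p. *)
Lemma step_invariant n p x y : block_step M n p -> same_block M x y ->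
  n < x < p <-> n < y < p.
Proof.
move=> np; apply: (@same_block_invariant (fun x => n < x < p)) => {}x {}y xy.
have npL := block_step_lt np; have xyL := block_step_lt xy.
have c1 := match_noncrossing mM np xy; have c2 := match_noncrossing mM xy np.
have yNp : n < x -> y <> p.
  by move=> nx e; subst y; have := match_src mM np xy; lia.
have xNn : y < p -> x <> n.
  by move=> yp e; subst x; have := match_tgt mM np xy; lia.
by split=> ?; [have ? := yNp _|have ? := xNn _]; apply: contrapT => ?;
  (apply: c1 || apply: c2); lia.
Qed.

(** An arc (2n + 1, 2m) encloses every block that meets the interval [m, n]. *)
Lemma hull_invariant m n x y : M (2 * n + 1) (2 * m) -> same_block M x y ->
  m <= x <= n <-> m <= y <= n.
Proof.
move=> nm; apply: (@same_block_invariant (fun x => m <= x <= n)) => {}x {}y xy.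
have nmL := match_admissible mM nm; rewrite /admissible in nmL.
have xyL := block_step_lt xy.
have c1 := match_noncrossing mM nm xy; have c2 := match_noncrossing mM xy nm.
have xNn : x <> n.
  by move=> e; subst x; apply: (match_srctgt mM nm); exact: xy.
have yNm : y <> m.
  by move=> e; subst y; apply: (match_srctgt mM xy); exact: nm.
by split=> ?; apply: contrapT => ?; (apply: c1 || apply: c2); lia.
Qed.

(** The two kinds of arcs at the point 2n + 1. *)
Lemma perfect_odd n :
  (exists p, block_step M n p) \/ (exists2 m, m <= n & M (2 * n + 1) (2 * m)).
Proof.
have [w [nw|wn]] := pM (2 * n + 1); have := match_admissible mM;
  rewrite /admissible => adm.
  right; have := adm _ _ nw => h; exists (w %/ 2)%Z; first lia.
  by have -> : 2 * (w %/ 2)%Z = w by lia.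
left; have := adm _ _ wn => h; exists (w %/ 2)%Z; rewrite /block_step.
by have -> : 2 * (w %/ 2)%Z = w by lia.
Qed.

(** The two kinds of arcs at the point 2p. *)
Lemma perfect_even p :
  (exists n, block_step M n p) \/ (exists2 n, p <= n & M (2 * n + 1) (2 * p)).
Proof.
have [w [nw|wn]] := pM (2 * p); have := match_admissible mM;
  rewrite /admissible => adm.
  left; have := adm _ _ nw => h; exists (w %/ 2)%Z; rewrite /block_step.
  by have -> : 2 * (w %/ 2)%Z + 1 = w by lia.
right; have := adm _ _ wn => h; exists (w %/ 2)%Z; first lia.
by have -> : 2 * (w %/ 2)%Z + 1 = w by lia.
Qed.

Let sb_refl x : same_block M x x := rst_refl _ _ x.
Let sb_sym x y : same_block M x y -> same_block M y x := rst_sym _ _ x y.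
Let sb_trans x y z : same_block M x y -> same_block M y z -> same_block M x z :=
  rst_trans _ _ x y z.
Let sb_step x y : block_step M x y -> same_block M x y := rst_step _ _ x y.


(** The greatest element k of a block has no successor, hence is the upper end of
an enclosing arc. *)
Lemma block_ubound_hull n b : ubound [set x | same_block M n x] b ->
  exists m k, same_block M n k /\ M (2 * k + 1) (2 * m).
Proof.
move=> ub; have [||k [/= nk maxk]] := @int_ubound_has_maximum [set x | same_block M n x] b.
- by exists n; exact: sb_refl.
- exact: ub.
case: (perfect_odd k) => [[p kp]|[m _ km]]; last by exists m, k.
have := maxk _ (sb_trans nk (sb_step kp)).
by have := block_step_lt kp; lia.
Qed.

Lemma block_lbound_hull n b : lbound [set x | same_block M n x] b ->
  exists m k, same_block M n m /\ M (2 * k + 1) (2 * m).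
Proof.
move=> lb; have [||m [/= nm minm]] := @int_lbound_has_minimum [set x | same_block M n x] b.
- by exists n; exact: sb_refl.
- exact: lb.
case: (perfect_even m) => [[p pm]|[k _ km]]; last by exists m, k.
have := minm _ (sb_trans nm (sb_sym (sb_step pm))).
by have := block_step_lt pm; lia.
Qed.

Lemma hull_le m n : M (2 * n + 1) (2 * m) -> m <= n.
Proof. by move=> /(match_admissible mM); rewrite /admissible; lia. Qed.

Lemma block_infinite_unbounded n : infinite_set [set x | same_block M n x] ->
  ~ has_ubound [set x | same_block M n x] /\
  ~ has_lbound [set x | same_block M n x].
Proof.
move=> infn; split=> -[b bP]; apply: infn.
  have [m [k [nk km]]] := block_ubound_hull bP.
  apply: (@finite_int_interval _ m k) => x /= nx; have := hull_le km.
  by have [] := hull_invariant km (sb_trans (sb_sym nk) nx); lia.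
have [m [k [nm km]]] := block_lbound_hull bP.
apply: (@finite_int_interval _ m k) => x /= nx; have := hull_le km.
by have [] := hull_invariant km (sb_trans (sb_sym nm) nx); lia.
Qed.

Lemma block_step_consecutive n p :
  block_step M n p <-> consecutive (same_block M) n p.
Proof.
split=> [np|[ltnp np notbtw]].
  split; [exact: block_step_lt|exact: sb_step|].
  by move=> x btw nx; have [] := step_invariant np nx; lia.
case: (perfect_odd n) => [[q nq]|[m mn nm]]; last first.
  by have [] := hull_invariant nm np; lia.
have [->|/eqP qp] := eqVneq p q; first by [].
have := block_step_lt nq; have [] := step_invariant nq np.
by have := notbtw q _ (sb_step nq); lia.
Qed.

(** An arc (2n + 1, 2m) joins the extremes of one block.  That m and n share a
block is the only delicate point: the least element of the block of n is the
lower end of an arc which would otherwise cross (2n + 1, 2m) or share an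
endpoint with it. *)
Lemma hull_extremes m n :
  M (2 * n + 1) (2 * m) <-> extremes (same_block M) m n.
Proof.
have hull_bounds k l x : M (2 * l + 1) (2 * k) -> same_block M l x -> k <= x <= l.
  by move=> lk lx; have := hull_le lk; have [] := hull_invariant lk lx; lia.
have hull_same k l : M (2 * l + 1) (2 * k) -> same_block M k l.
  move=> lk; have kl := hull_le lk.
  have [||j [/= lj minj]] := @int_lbound_has_minimum [set x | same_block M l x] k.
  - by exists l; exact: sb_refl.
  - by move=> x /= lx; have := hull_bounds _ _ _ lk lx; lia.
  case: (perfect_even j) => [[i ij]|[l' jl' l'j]].
    have := minj _ (sb_trans lj (sb_sym (sb_step ij))).
    by have := block_step_lt ij; lia.
  have kj := hull_bounds _ _ _ lk lj.
  have [] := hull_invariant l'j (sb_sym lj) => jl _.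
  have [kj'|kj'] := eqVneq k j; first by subst j; exact: sb_sym.
  have [e|ll'] := eqVneq l l'.
    by subst l'; have := match_src mM lk l'j; lia.
  by case: (match_noncrossing mM l'j lk); lia.
split=> [nm|[mn smn bnd]].
  by split; [exact: hull_le|exact: hull_same|move=> x; exact: hull_bounds].
case: (perfect_odd n) => [[p np]|[k kn nk]].
  by have := bnd _ (sb_step np); have := block_step_lt np; lia.
have := bnd _ (sb_sym (hull_same _ _ nk)).
have := hull_bounds _ _ _ nk (sb_sym smn).
by move=> ? ?; have -> : m = k by lia.
Qed.

(** A perfect matching is determined by its blocks. *)
Lemma perfect_matchingE t u : M t u <-> arcs_of (same_block M) t u.
Proof.
split=> [tu|[[n [p [-> -> /block_step_consecutive //]]]|]]; last first.
  by move=> [m [n [-> -> /hull_extremes]]].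
have := match_admissible mM tu; rewrite /admissible => adm.
have [e|e] : (t = 2 * (t %/ 2)%Z /\ u = 2 * (u %/ 2)%Z + 1) \/
   (t = 2 * (t %/ 2)%Z + 1 /\ u = 2 * (u %/ 2)%Z) by lia.
- left; exists (u %/ 2)%Z, (t %/ 2)%Z; case: e => t2 u2; split=> //.
  by apply/block_step_consecutive; rewrite /block_step -t2 -u2.
- right; exists (u %/ 2)%Z, (t %/ 2)%Z; case: e => t2 u2; split=> //.
  by apply/hull_extremes; rewrite -t2 -u2.
Qed.

Lemma same_block_noncrossing : noncrossing_rel (same_block M).
Proof.
move=> a b c e ab bc ce ac be; apply: contrapT => aNb.
(* Let n be the last element below b of the block of a.  It has a successor p,
   as its block contains c > n.  The interval from n to p contains b, hence e,
   hence c; but c lies in the block of n. *)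
have [||n [/= [an nb] maxn]] :=
    @int_ubound_has_maximum [set x | same_block M a x /\ x < b] b.
- by exists a; split; [exact: sb_refl|].
- by move=> x /= [_]; lia.
have sacn : same_block M n c := sb_trans (sb_sym an) ac.
have a_n : a <= n by apply: maxn; split; [exact: sb_refl|].
case: (perfect_odd n) => [[p np]|[m mn nm]]; last first.
  by have [] := hull_invariant nm sacn; lia.
have ap : same_block M a p := sb_trans an (sb_step np).
have npL := block_step_lt np.
have pb : ~ p < b by move=> pb; have := maxn p (conj ap pb); lia.
have pNb : p <> b by move=> pb'; subst p.
have [] := step_invariant np be; have [] := step_invariant np sacn.
lia.
Qed.

End Blocks.

(** * The matching of a noncrossing equivalence relation *)

Section MatchingOf.
Variable R : int -> int -> Prop.
Hypothesis Rrefl : forall x, R x x.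
Hypothesis Rsym : forall x y, R x y -> R y x.
Hypothesis Rtrans : forall x y z, R x y -> R y z -> R x z.
Hypothesis Rnc : noncrossing_rel R.
(* This is what the absence of infinite blocks bounded on one side provides. *)
Hypothesis Rbnd : forall n,
  has_ubound [set x | R n x] <-> has_lbound [set x | R n x].

Lemma arcs_of_partial_matching : partial_matching (arcs_of R).
Proof.
split.
- move=> t u [[n [p [-> -> []]]]|[m [n [-> -> []]]]]; rewrite /admissible; lia.
- move=> t u u' [[n [p [-> -> [np Rnp b]]]]|[m [n [-> -> [mn Rmn b]]]]]
    [[n' [p' [e -> [np' Rnp' b']]]]|[m' [n' [e -> [mn' Rmn' b']]]]]; try lia.
  + have ? : p' = p by lia. subst p'.
    have n1 : ~ n < n' < p by move=> /b; apply; exact: Rtrans Rnp (Rsym Rnp').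
    have n2 : ~ n' < n < p by move=> /b'; apply; exact: Rtrans Rnp' (Rsym Rnp).
    lia.
  + have ? : n' = n by lia. subst n'.
    by have := b _ (Rsym Rmn'); have := b' _ (Rsym Rmn); lia.
- move=> t t' u [[n [p [-> -> [np Rnp b]]]]|[m [n [-> -> [mn Rmn b]]]]]
    [[n' [p' [-> e [np' Rnp' b']]]]|[m' [n' [-> e [mn' Rmn' b']]]]]; try lia.
  + have ? : n' = n by lia. subst n'.
    have n1 : ~ n < p' < p by move=> /b; apply.
    have n2 : ~ n < p < p' by move=> /b'; apply.
    lia.
  + have ? : m' = m by lia. subst m'.
    have := b _ (Rtrans (Rsym Rmn) Rmn').
    by have := b' _ (Rtrans (Rsym Rmn') Rmn); lia.
- move=> t u v [[n [p [-> _ [np Rnp b]]]]|[m [n [-> _ [mn Rmn b]]]]]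
    [[n' [p' [_ e [np' Rnp' b']]]]|[m' [n' [_ e [mn' Rmn' b']]]]]; try lia.
  + have ? : m' = p by lia. subst m'.
    by have := b' _ (Rtrans (Rsym Rmn') (Rsym Rnp)); lia.
  + have ? : n' = n by lia. subst n'.
    by have := b _ Rnp'; lia.
- move=> t u t' u' [[n [p [-> -> [np Rnp b]]]]|[m [n [-> -> [mn Rmn b]]]]]
    [[n' [p' [-> -> [np' Rnp' b']]]]|[m' [n' [-> -> [mn' Rmn' b']]]]] h1 h2 h3.
  + have Rn'n : R n' n by apply: (Rnc _ _ _ Rnp' Rnp); lia.
    by apply: (b' n) => //; lia.
  + have Rm'n : R m' n.
      have [e|e] := eqVneq m' n; first by rewrite e.
      by apply: (Rnc _ _ _ Rmn' Rnp); lia.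
    have := b' _ (Rtrans (Rsym Rmn') (Rtrans Rm'n Rnp)); lia.
  + have Rn'm : R n' m.
      have [e|e] := eqVneq p' n.
        by subst p'; exact: Rtrans Rnp' (Rsym Rmn).
      by apply: (Rnc _ _ _ Rnp' Rmn); lia.
    by have := b _ (Rsym (Rtrans Rn'm Rmn)); lia.
  + have Rm'm : R m' m.
      have [e|e] := eqVneq m n'; first by rewrite e.
      by apply: (Rnc _ _ _ Rmn' Rmn); lia.
    by have := b _ (Rsym (Rtrans Rm'm Rmn)); lia.
Qed.

Lemma consecutive_above x y : R x y -> x < y ->
  exists2 p, consecutive R x p & p <= y.
Proof.
move=> xy ltxy.
have [||p [/= [xp Rxp] minp]] :=
    @int_lbound_has_minimum [set z | x < z /\ R x z] x.
- by exists y.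
- by move=> z /= [] /ltW.
exists p; last exact: minp.
by split=> // z btw xz; have := minp z; move=> /(_ (conj _ xz)); lia.
Qed.

Lemma consecutive_below x y : R x y -> x < y ->
  exists p, consecutive R p y.
Proof.
move=> xy ltxy.
have [||p [/= [py Rpy] maxp]] :=
    @int_ubound_has_maximum [set z | z < y /\ R z y] y.
- by exists x.
- by move=> z /= [] /ltW.
exists p; split=> // z btw pz.
by have := maxp z (conj _ (Rtrans (Rsym pz) Rpy)); lia.
Qed.

Lemma block_extremes x : has_ubound [set y | R x y] ->
  exists m n, [/\ extremes R m n, R x m & R x n].
Proof.
move=> hub; have [bl lb] : has_lbound [set y | R x y] by apply/Rbnd.
case: hub => bu ub.
have ne : [set y | R x y] !=set0 by exists x; exact: Rrefl.
have [m [/= xm minm]] := int_lbound_has_minimum ne lb.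
have [n [/= xn maxn]] := int_ubound_has_maximum ne ub.
exists m, n; split=> //; split; [exact: maxn|exact: Rtrans (Rsym xm) xn|].
move=> y ny; have xy := Rtrans xn ny.
by have := minm _ xy; have := maxn _ xy; lia.
Qed.

(** The point 2n + 1 is matched upwards if n has a successor; otherwise its class
has a greatest element, hence also a least one, and 2n + 1 is matched downwards.
The points 2n are treated dually. *)
Lemma arcs_of_perfect : perfect (arcs_of R).
Proof.
move=> v; have [e|e] : v = 2 * (v %/ 2)%Z + 1 \/ v = 2 * (v %/ 2)%Z by lia.
- set n := (v %/ 2)%Z in e.
  have [[y [ny lny]]|nomore] := pselect (exists y, R n y /\ n < y).
    have [p np _] := consecutive_above ny lny.
    by exists (2 * p); right; left; exists n, p.
  have maxn y : R n y -> y <= n.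
    by move=> ny; rewrite leNgt; apply/negP => lny; apply: nomore; exists y.
  have [|m [k [mk nm nk]]] := @block_extremes n; first by exists n.
  have kn : k = n by case: mk => _ _ /(_ _ (Rsym nk)); have := maxn _ nk; lia.
  by subst k; exists (2 * m); left; right; exists m, n.
- set n := (v %/ 2)%Z in e.
  have [[y [yn lyn]]|noless] := pselect (exists y, R y n /\ y < n).
    have [p pn] := consecutive_below yn lyn.
    by exists (2 * p + 1); left; left; exists p, n.
  have minn y : R n y -> n <= y.
    by move=> ny; rewrite leNgt; apply/negP => lyn; apply: noless; exists y;
      split=> //; exact: Rsym.
  have [|m [k [mk nm nk]]] := @block_extremes n.
    by apply/Rbnd; exists n.
  have mn : m = n.
    case: mk => _ _ /(_ _ (Rsym nk)); have := minn _ nm => ? ?.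
    by apply: le_anti; lia.
  by subst m; exists (2 * k + 1); right; right; exists n, k.
Qed.

Lemma same_block_arcs_of x y : same_block (arcs_of R) x y <-> R x y.
Proof.
split.
  elim=> {x y} [x y|//|x y _ /Rsym //|x y z _ xy _ yz]; last exact: Rtrans xy yz.
  move=> [[n [p [e1 e2 [_ Rnp _]]]]|[m [n [e1 e2 _]]]]; last lia.
  have ? : x = n by lia. have ? : y = p by lia. by subst.
(* Walk from x to y along successors. *)
have up (k : nat) : forall x y, y - x = k%:Z -> R x y -> same_block (arcs_of R) x y.
  elim/ltn_ind: k => k IH {}x {}y yx Rxy.
  have [->|xNy] := eqVneq x y; first exact: rst_refl.
  have [p xp py] := consecutive_above Rxy ltac:(lia).
  have [lxp Rxp _] := xp.
  apply: (@rst_trans _ _ _ p).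
    by apply: rst_step; left; exists x, p.
  apply: (IH (absz (y - p))); [lia|lia|exact: Rtrans (Rsym Rxp) Rxy].
have [xy|yx] := leP x y => Rxy; first by apply: (up `|y - x|%N) => //; lia.
by apply: rst_sym; apply: (up `|x - y|%N); [lia|exact: Rsym].
Qed.

End MatchingOf.

(** * Equivalence relations and partitions *)

(** The set of classes of an equivalence relation. *)
Definition classes (R : int -> int -> Prop) : set (set int) :=
  [set B | exists n, B = [set p | R n p]].

(** The equivalence relation of a partition. *)
Definition share_block (P : set (set int)) (x y : int) : Prop :=
  exists2 B, P B & B x /\ B y.

Section Classes.
Variable R : int -> int -> Prop.
Hypothesis Rrefl : forall x, R x x.
Hypothesis Rsym : forall x y, R x y -> R y x.
Hypothesis Rtrans : forall x y z, R x y -> R y z -> R x z.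

Lemma class_eq m n : R m n -> [set p | R m p] = [set p | R n p].
Proof.
move=> mn; apply/seteqP; split=> x /=; first exact: Rtrans (Rsym mn).
exact: Rtrans.
Qed.

Lemma share_block_classes x y : share_block (classes R) x y <-> R x y.
Proof.
split=> [[_ [n ->] /= [nx ny]]|xy]; first exact: Rtrans (Rsym nx) ny.
by exists [set p | R x p]; [exists x|split=> //=].
Qed.

Lemma classes_partition : partition (classes R) id setT.
Proof.
split.
- apply/seteqP; split=> // x _.
  by exists [set p | R x p]; [exists x|exact: Rrefl].
- move=> _ _ [m ->] [n ->] [x /= [mx nx]]; apply: class_eq.
  exact: Rtrans mx (Rsym nx).
- by move=> _ [n ->]; exists n; exact: Rrefl.
Qed.

Lemma classes_noncrossing : noncrossing_rel R -> noncrossing (classes R).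
Proof.
move=> ncR _ _ [m ->] [n ->] mNn [a [b [c [e [[ab bc ce] /= [ma mc nb ne]]]]]].
apply: mNn; apply: class_eq.
have Rab : R a b.
  by apply: ncR ab bc ce _ _; [exact: Rtrans (Rsym ma) mc|exact: Rtrans (Rsym nb) ne].
exact: Rtrans ma (Rtrans Rab (Rsym nb)).
Qed.

End Classes.

Section Partitions.
Variable P : set (set int).
Hypothesis Ppart : partition P id setT.

Lemma share_block_refl x : share_block P x x.
Proof.
case: Ppart => cP _ _; have [B PB Bx] : cover P id x by rewrite cP.
by exists B.
Qed.

Lemma share_block_sym x y : share_block P x y -> share_block P y x.
Proof. by move=> [B PB [Bx By]]; exists B. Qed.

Lemma share_block_trans x y z :
  share_block P x y -> share_block P y z -> share_block P x z.
Proof.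
case: Ppart => _ tP _ [B PB [Bx By]] [B' PB' [B'y B'z]].
have BB' : B = B' by apply: tP => //; exists y.
by exists B => //; split; rewrite // BB'.
Qed.

Lemma block_share_block B n : P B -> B n -> [set x | share_block P n x] = B.
Proof.
case: Ppart => _ tP _ PB Bn; apply/seteqP; split=> x /=; last by exists B.
move=> [B' PB' [B'n B'x]]; suff -> : B = B' by [].
by apply: tP => //; exists n.
Qed.

Lemma classes_share_block : classes (share_block P) = P.
Proof.
apply/seteqP; split=> [_ [n ->]|B PB].
  by have [B PB [Bn _]] := share_block_refl n; rewrite (block_share_block PB Bn).
case: Ppart => _ _ /(_ _ PB)[n Bn].
by exists n; rewrite (block_share_block PB Bn).
Qed.

Lemma share_block_noncrossing : noncrossing P -> noncrossing_rel (share_block P).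
Proof.
move=> ncP a b c e ab bc ce [B PB [Ba Bc]] [B' PB' [B'b B'e]].
have [BB'|BNB'] := pselect (B = B'); first by exists B; rewrite // BB' -{1}BB'.
by exfalso; apply: (ncP _ _ PB PB' BNB'); exists a, b, c, e.
Qed.

Lemma share_block_bounded n : infinite_blocks_unbounded P ->
  has_ubound [set x | share_block P n x] <-> has_lbound [set x | share_block P n x].
Proof.
move=> infP; have [B PB [Bn _]] := share_block_refl n.
rewrite (block_share_block PB Bn).
have [finB|infB] := pselect (finite_set B); last first.
  by have [] := infP _ PB infB.
by split=> _; [exact: finite_int_lbound|exact: finite_int_ubound].
Qed.

(** Two distinct infinite blocks, being unbounded above, would interleave. *)
Lemma unbounded_block_unique :
  noncrossing P -> infinite_blocks_unbounded P -> at_most_one_infinite_block P.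
Proof.
move=> ncP infP B B' PB PB' infB infB'; apply: contrapT => BNB'.
have above D x : P D -> infinite_set D -> exists2 y, D y & x < y.
  move=> PD infD; have [nub _] := infP _ PD infD.
  apply: contrapT => no; apply: nub; exists x => y Dy.
  by rewrite leNgt; apply/negP => xy; apply: no; exists y.
have [a Ba] : B !=set0 by case: Ppart => _ _; exact.
have [b B'b ab] := above _ a PB' infB'.
have [c Bc bc] := above _ b PB infB.
have [e B'e ce] := above _ c PB' infB'.
by apply: (ncP _ _ PB PB' BNB'); exists a, b, c, e.
Qed.

End Partitions.

(** * Isomorphisms and vanishing of morphism spaces *)

Local Open Scope lincat_scope.

Section LinearCategory.
Context {K : fieldType} {C : linCat K}.
Implicit Types x y z : C.

Lemma comp0m x y z (f : hom x y) : (0 : hom y z) \oc f = 0.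
Proof.
have := comp_linearl f (-1) (0 : hom y z) 0.
by rewrite scaler0 addr0 scaleN1r addNr.
Qed.

Lemma compm0 x y z (g : hom y z) : g \oc (0 : hom x y) = 0.
Proof.
have := comp_linearr g (-1) (0 : hom x y) 0.
by rewrite scaler0 addr0 scaleN1r addNr.
Qed.

Lemma compmD x y z (g : hom y z) (f f' : hom x y) :
  g \oc (f + f') = g \oc f + g \oc f'.
Proof. by have := comp_linearr g 1 f f'; rewrite !scale1r. Qed.

Lemma compDm x y z (g g' : hom y z) (f : hom x y) :
  (g + g') \oc f = g \oc f + g' \oc f.
Proof. by have := comp_linearl f 1 g g'; rewrite !scale1r. Qed.

Lemma isom_refl x : isom x x.
Proof. by exists (idm x), (idm x); rewrite comp1m. Qed.

Lemma isom_sym x y : isom x y -> isom y x.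
Proof. by move=> [f [g [gf fg]]]; exists g, f. Qed.

Lemma isom_trans x y z : isom x y -> isom y z -> isom x z.
Proof.
move=> [f [f' [f'f ff']]] [g [g' [g'g gg']]]; exists (g \oc f), (f' \oc g').
split; first by rewrite compA -(compA f') g'g compm1.
by rewrite compA -(compA g) ff' compm1.
Qed.

Lemma is_zero_isom x y : isom x y -> is_zero x -> is_zero y.
Proof.
move=> [f [g [gf fg]]] x0; rewrite /is_zero -fg.
by rewrite -[f]compm1 x0 compm0 comp0m.
Qed.

Lemma is_biproduct_isom x y z z' :
  isom z z' -> is_biproduct x y z -> is_biproduct x y z'.
Proof.
move=> [f [g [gf fg]]] [i1 [i2 [p1 [p2 [e1 e2 e3 e4 e5]]]]].
exists (f \oc i1), (f \oc i2), (p1 \oc g), (p2 \oc g).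
have mid t t' (p : hom z t) (i : hom t' z) : (p \oc g) \oc (f \oc i) = p \oc i.
  by rewrite compA -(compA p) gf compm1.
rewrite !mid; split=> //.
have out t (i : hom t z) (p : hom z t) : (f \oc i) \oc (p \oc g) = f \oc (i \oc p) \oc g.
  by rewrite !compA.
by rewrite !out -compDm -compmD e5 compm1.
Qed.

Lemma indecomposable_isom x y : isom x y -> indecomposable x -> indecomposable y.
Proof.
move=> xy [xN0 xind]; split=> [y0|u v uv].
  by apply: xN0; apply: is_zero_isom y0; exact: isom_sym.
by apply: xind; apply: is_biproduct_isom uv; exact: isom_sym.
Qed.

End LinearCategory.

Lemma hom_zero_isom (K : fieldType) (T : triCat K) (x x' y y' : T) :
  isom x x' -> isom y y' -> hom_zero x y -> hom_zero x' y'.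
Proof.
move=> [a [a' [_ aa']]] [b [b' [_ bb']]] xy0 f.
rewrite -[f]compm1 -aa' -[f]comp1m -bb'.
have -> : (b \oc b') \oc f \oc (a \oc a') = b \oc (b' \oc f \oc a) \oc a'.
  by rewrite !compA.
by rewrite (xy0 (b' \oc f \oc a)) compm0 comp0m.
Qed.

Lemma shift_isom_reflect (K : fieldType) (T : triCat K) (x y : T) :
  isom (shift T x) (shift T y) -> isom x y.
Proof.
move=> [f [g [gf fg]]].
have [fi _ fiK] := shift_ff x y; have [gi _ giK] := shift_ff y x.
have inj z : injective (@fmap _ _ _ (shift T) z z) by exact: bij_inj (shift_ff z z).
by exists (fi f), (gi g); split; apply: inj; rewrite fmapM fiK giK fmap1.
Qed.

Lemma has_dim0 (K : fieldType) (V : lmodType K) : has_dim V 0 -> forall v : V, v = 0.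
Proof.
by move=> [[f _ fbij]] v; apply: (bij_inj fbij); apply/rowP => -[].
Qed.

Lemma has_dim1 (K : fieldType) (V : lmodType K) :
  has_dim V 1 -> exists v : V, v <> 0.
Proof.
move=> [[f flin [g gK fK]]]; exists (g (const_mx 1)) => g10.
have f0 : f 0 = 0 by have := flin (-1) 0 0; rewrite scaler0 addr0 scaleN1r addNr.
have := fK (const_mx 1); rewrite g10 f0 => /rowP/(_ ord0); rewrite !mxE.
by apply/eqP; rewrite eq_sym oner_eq0.
Qed.

Section ArcModel.
Context {K : fieldType} {T : triCat K} (phi : arc_model T).

Lemma hom_zero_arc (a b : arc) : hom_zero (phi a) (phi b) <-> ~ hom_support a b.
Proof.
split=> [ab0 ab|/(arc_hom0 phi)]; last exact: has_dim0.
by have [f] := has_dim1 (arc_hom1 phi ab); apply; exact: ab0.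
Qed.

Lemma unshift_arc (x : T) (a : arc) :
  isom x (phi a) -> isom (unshift x) (phi (arc_up a)).
Proof.
move=> xa; apply: shift_isom_reflect; apply: isom_trans (unshiftK x) _.
apply: isom_trans xa _; apply: isom_sym; apply: arc_shift => /=; lia.
Qed.

(** * Riedtmann configurations as matchings *)

(** The arcs of the indecomposable objects in a collection. *)
Definition arcs_in (C : set T) : set arc := [set a | C (phi a)].

(** Both instances i = 0 and i = -1 of condition (a) translate to arcs. *)
Lemma hom_orthogonalP (C : set T) : collection C ->
  hom_orthogonal C <-> arcs_orthogonal (arcs_in C).
Proof.
move=> [indC isoC]; split=> [orthC a b Ca Cb aNb|orthA x y Cx Cy xNy i ii].
  have nab : ~ isom (phi a) (phi b) by move=> /arc_inj.
  split; apply/hom_zero_arc; first exact: orthC nab 0 (or_intror erefl).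
  apply: hom_zero_isom (isom_refl _) (unshift_arc (isom_refl _)) _.
  exact: orthC nab (-1) (or_introl erefl).
have [a xa] := arc_surj phi (indC _ Cx); have [b yb] := arc_surj phi (indC _ Cy).
have aNb : a <> b.
  by move=> ab; subst b; apply: xNy; apply: isom_trans xa (isom_sym yb).
have [ab0 ab1] := orthA _ _ (isoC _ _ Cx xa) (isoC _ _ Cy yb) aNb.
case: ii => ->.
  apply: hom_zero_isom (isom_sym xa) (isom_sym (unshift_arc yb)) _.
  exact/hom_zero_arc.
by apply: hom_zero_isom (isom_sym xa) (isom_sym yb) _; exact/hom_zero_arc.
Qed.

Lemma left_dominatingP (C : set T) : collection C ->
  (forall z, indecomposable z -> exists2 x, C x & ~ hom_zero x z) <->
  (forall b, exists2 a, arcs_in C a & hom_support a b).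
Proof.
move=> [indC isoC]; split=> [domC b|domA z /(arc_surj phi)[b zb]].
  have [x Cx xb] := domC _ (arc_indec phi b).
  have [a xa] := arc_surj phi (indC _ Cx).
  exists a; first exact: isoC Cx xa.
  apply: contrapT => /hom_zero_arc ab0; apply: xb.
  exact: hom_zero_isom (isom_sym xa) (isom_refl _) ab0.
have [a Ca ab] := domA b; exists (phi a) => // az0.
suff /hom_zero_arc : hom_zero (phi a) (phi b) by [].
exact: hom_zero_isom (isom_refl _) zb az0.
Qed.

Lemma right_dominatingP (C : set T) : collection C ->
  (forall z, indecomposable z -> exists2 x, C x & ~ hom_zero z x) <->
  (forall b, exists2 a, arcs_in C a & hom_support b a).
Proof.
move=> [indC isoC]; split=> [domC b|domA z /(arc_surj phi)[b zb]].
  have [x Cx xb] := domC _ (arc_indec phi b).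
  have [a xa] := arc_surj phi (indC _ Cx).
  exists a; first exact: isoC Cx xa.
  apply: contrapT => /hom_zero_arc ab0; apply: xb.
  exact: hom_zero_isom (isom_refl _) (isom_sym xa) ab0.
have [a Ca ab] := domA b; exists (phi a) => // az0.
suff /hom_zero_arc : hom_zero (phi b) (phi a) by [].
exact: hom_zero_isom zb (isom_refl _) az0.
Qed.

Lemma arc_upP (b : arc) : exists a, b = arc_up a.
Proof.
have adm : admissible (src b - 1) (tgt b - 1).
  by have := arcP b; rewrite /admissible; lia.
by exists (Arc adm); apply: arc_eq => /=; lia.
Qed.

(** The left and right notions agree because of [hom_support_serre]. *)
Lemma riedtmannP (C : set T) :
  riedtmann C <-> [/\ collection C, partial_matching (arcs_rel (arcs_in C))
                    & perfect (arcs_rel (arcs_in C))].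
Proof.
split=> [[[coll orth dom]|[coll orth dom]]|[coll mC pC]].
- have mC := (arcs_orthogonalP _).1 ((hom_orthogonalP coll).1 orth).
  by split=> //; apply/(perfect_hom_support mC)/(left_dominatingP coll).
- have mC := (arcs_orthogonalP _).1 ((hom_orthogonalP coll).1 orth).
  split=> //; apply/(perfect_hom_support mC) => b.
  have [c ->] := arc_upP b; have [a Ca ca] := (right_dominatingP coll).1 dom c.
  by exists a => //; exact: (hom_support_serre _ _).1.
- left; split=> //; first exact/(hom_orthogonalP coll)/arcs_orthogonalP.
  exact/(left_dominatingP coll)/(perfect_hom_support mC).
Qed.

Lemma next_eltE (H : set T) :
  next_elt phi H = block_step (arcs_rel (arcs_in H)).
Proof.
apply/funext => n; apply/funext => p; apply/propext.
have tgtE (m : int) : m%:~R = zprime n + 1 / 2%:R <-> m = 2 * n + 1.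
  have -> : zprime n + 1 / 2%:R = (2 * n + 1)%:~R.
    by rewrite /zprime intrD intrM; field.
  by split=> [/intr_inj|->].
have srcE (m : int) : zprime p = m%:~R + 1 / 2%:R <-> m = 2 * p.
  have -> : zprime p = (2 * p)%:~R + 1 / 2%:R.
    by rewrite /zprime intrM; field.
  by split=> [/addIr/intr_inj|->].
split=> -[a [Ha h1 h2]]; exists a; split=> //.
- exact/srcE.
- exact/tgtE.
- exact/tgtE.
- exact/srcE.
Qed.

(** The map f only depends on the matching of [H]. *)
Lemma config_partitionE (H : set T) :
  config_partition phi H = classes (same_block (arcs_rel (arcs_in H))).
Proof. by rewrite /config_partition next_eltE. Qed.

(** The collection of indecomposable objects with arcs in [M]. *)
Definition objects_of (M : int -> int -> Prop) : set T :=
  [set x | exists2 a, isom x (phi a) & M (src a) (tgt a)].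

Lemma objects_of_collection M : collection (objects_of M).
Proof.
split=> [x [a xa _]|x y [a xa Ma] xy].
  exact: indecomposable_isom (isom_sym xa) (arc_indec phi a).
by exists a => //; exact: isom_trans (isom_sym xy) xa.
Qed.

Lemma arcs_rel_objects_of M : partial_matching M ->
  arcs_rel (arcs_in (objects_of M)) = M.
Proof.
move=> mM; apply/funext => t; apply/funext => u; apply/propext; split.
  by move=> [a [[b /arc_inj -> Mb] <- <-]].
move=> Mtu; exists (Arc (match_admissible mM Mtu)); split=> //.
by exists (Arc (match_admissible mM Mtu)); [exact: isom_refl|].
Qed.

Lemma collection_arcs_rel (C C' : set T) : collection C -> collection C' ->
  arcs_rel (arcs_in C) = arcs_rel (arcs_in C') -> C = C'.
Proof.
have sub D D' : collection D -> collection D' ->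
    arcs_rel (arcs_in D) = arcs_rel (arcs_in D') -> D `<=` D'.
  move=> [indD isoD] [_ isoD'] DD' x Dx; have [a xa] := arc_surj phi (indD _ Dx).
  have : arcs_rel (arcs_in D) (src a) (tgt a).
    by exists a; split=> //; exact: isoD xa.
  rewrite DD' => -[b [D'b sb tb]]; apply: isoD' D'b _.
  by rewrite (arc_eq sb tb); exact: isom_sym.
by move=> cC cC' CC'; apply/seteqP; split; apply: sub.
Qed.

End ArcModel.

Theorem proposition7p3 (K : closedFieldType) (T : triCat K) (s : T)
    (Ticomp : idempotent_complete T) (Talg : algebraic T)
    (s_spherical : spherical_m1 s) (s_generates : classical_generator s)
    (phi : arc_model T) :
  set_bij [set C : set T | riedtmann C]
          [set P : set (set int) |
            [/\ noncrossing_partition P, at_most_one_infinite_block P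
              & infinite_blocks_unbounded P]]
          (fun H : set T => config_partition phi H).
Proof.
have sb_refl M x : same_block M x x := rst_refl _ _ x.
have sb_sym M x y : same_block M x y -> same_block M y x := rst_sym _ _ x y.
have sb_trans M x y z : same_block M x y -> same_block M y z -> same_block M x z :=
  rst_trans _ _ x y z.
split.
- move=> C /= /(riedtmannP phi)[_ mC pC]; rewrite config_partitionE.
  set M := arcs_rel _ in mC pC *; set R := same_block M.
  have part : partition (classes R) id setT.
    exact: classes_partition (sb_refl M) (sb_sym M) (sb_trans M).
  have nc : noncrossing (classes R).
    apply: classes_noncrossing (sb_sym M) (sb_trans M) _.
    exact: same_block_noncrossing.
  have unb : infinite_blocks_unbounded (classes R).
    by move=> _ [n ->]; exact: block_infinite_unbounded.
  by split=> //; exact: unbounded_block_unique.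
- move=> C C'; rewrite !inE /= => /(riedtmannP phi)[cC mC pC] /(riedtmannP phi)[cC' mC' pC'].
  rewrite !config_partitionE => CC'; apply: collection_arcs_rel => //.
  have same : same_block (arcs_rel (arcs_in phi C)) =
              same_block (arcs_rel (arcs_in phi C')).
    apply/funext => x; apply/funext => y; apply/propext.
    have same_classes M :=
      @share_block_classes _ (sb_refl M) (sb_sym M) (sb_trans M) x y.
    by rewrite -same_classes CC' same_classes.
  apply/funext => t; apply/funext => u; apply/propext.
  have MC := perfect_matchingE mC pC t u.
  have MC' := perfect_matchingE mC' pC' t u.
  by rewrite same in MC; split=> [/MC/MC'|/MC'/MC].
- move=> P /= [[Ppart Pnc] _ Punb].
  have Rr := share_block_refl Ppart; have Rs := @share_block_sym P.
  have Rt := share_block_trans Ppart.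
  have Rnc := share_block_noncrossing Pnc.
  have Rbnd n := share_block_bounded Ppart n Punb.
  have mM := arcs_of_partial_matching Rr Rs Rt Rnc.
  have pM := arcs_of_perfect Rr Rs Rt Rbnd.
  exists (objects_of phi (arcs_of (share_block P))).
    apply/(riedtmannP phi); rewrite arcs_rel_objects_of //; split=> //.
    exact: objects_of_collection.
  rewrite config_partitionE arcs_rel_objects_of // -[RHS](classes_share_block Ppart).
  congr classes; apply/funext => x; apply/funext => y; apply/propext.
  exact: same_block_arcs_of.
Qed.
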